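(* There exists a real quantum Latin square of order six with cardinality $29$. That is, there exists an array $\Phi=(\phi_{ij})_{0\le i,j\le 5}$ of unit vectors $\phi_{ij}\in\mathbb{R}^6\subset\mathbb{C}^6$ such that every row $(\phi_{ij})_{0\le j\le 5}$ and every column $(\phi_{ij})_{0\le i\le 5}$ is an orthonormal basis of $\mathbb{C}^6$, and such that the set of rays $\{[\phi_{ij}]: 0\le i,j\le 5\}$ has exactly $29$ elements.
   Context: For a nonzero vector $x\in\mathbb{C}^n$, its ray is $[x]=\{\lambda x:\lambda\in\mathbb{C}\setminus\{0\}\}$. A quantum Latin square of order $n$, denoted $\mathrm{QLS}(n)$, is an array $\Phi=(\phi_{ij})_{i,j\in\{0,\dots,n-1\}}$ of unit vectors $\phi_{ij}\in\mathbb{C}^n$ such that every row and every column is an orthonormal basis of $\mathbb{C}^n$. Its cardinality is $\operatorname{card}(\Phi)=|\{[\phi_{ij}]: i,j\in\{0,\dots,n-1\}\}|$, the number of distinct rays among its entries. $\Phi$ is called real if all its entries lie in $\mathbb{R}^n\subset\mathbb{C}^n$. *)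

(* Defs.v *)
From mathcomp Require Export all_boot all_order all_algebra complex.
From mathcomp Require Export sesquilinear spectral.
From mathcomp Require Export classical_sets cardinality reals.

Set Implicit Arguments.
Unset Strict Implicit.
Unset Printing Implicit Defensive.

Import Order.TTheory GRing.Theory Num.Theory.
Local Open Scope ring_scope.
Local Open Scope classical_set_scope.

Section QuantumLatinSquares.
Variables (R : realType) (n : nat).
Implicit Types (x : 'rV[R[i]]_n) (Phi : 'I_n -> 'I_n -> 'rV[R[i]]_n).

Definition ray x : set 'rV[R[i]]_n :=
  [set y | exists2 l : R[i], l != 0 & y = l *: x].

Definition orthonormal_basis (e : 'I_n -> 'rV[R[i]]_n) : Prop :=
  orthonormal (@dotmx R[i] n) (codom e) /\ basis_of fullv (codom e).

(* Orthonormality of the rows makes every entry a unit vector. *)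
Definition quantum_latin_square Phi : Prop :=
  (forall i, orthonormal_basis (fun j => Phi i j)) /\
  (forall j, orthonormal_basis (fun i => Phi i j)).

Definition real_array Phi : Prop := forall i j, Phi i j \is a realmx.

Definition rays Phi : set (set 'rV[R[i]]_n) :=
  [set r | exists i j, r = ray (Phi i j)].

End QuantumLatinSquares.

(* Main.v *)
(** All entries of the square are normalized integer vectors, so that
    orthogonality and (non-)proportionality are decided by integer arithmetic.
    The square has one ray, spanned by the last basis vector, in every row and
    column (on the diagonal); the other thirty entries lie in its orthogonal
    complement and coincide in exactly two pairs, at (0,2), (1,5) and at
    (4,0), (5,3), which leaves 1 + 28 rays. The vectors were obtained from a
    numerical solution: its zero pattern in the basis given by row 4 determines
    all entries rationally from five slopes subject to one equation, of which
    this is a small rational point. *)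

Require Import Defs.

Local Open Scope ring_scope.
Local Open Scope classical_set_scope.
Local Open Scope card_scope.

Import Order.TTheory GRing.Theory Num.Theory Num.Def.

Section IntegerRays.
Variables (R : realType) (n : nat).
Implicit Types u v : seq int.

(* A fold rather than a [\sum], so that it reduces by computation. *)
Definition int_dot u v : int :=
  foldr (fun k s => u`_k * v`_k + s) 0 (iota 0 n).

Definition int_row u : 'rV[R[i]]_n := \row_k (u`_k)%:~R.

Definition norm_row u : R[i] := sqrtC (int_dot u u)%:~R.

Definition unit_row u : 'rV[R[i]]_n := (norm_row u)^-1 *: int_row u.

Lemma int_dotE u v : int_dot u v = \sum_(k < n) u`_k * v`_k.
Proof.
by rewrite -(big_mkord xpredT (fun k => u`_k * v`_k)) /index_iota subn0 unlock.
Qed.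

Lemma int_dot_ge0 u : 0 <= int_dot u u.
Proof. by rewrite int_dotE sumr_ge0 // => k _; rewrite -expr2 sqr_ge0. Qed.

Lemma norm_row_real u : norm_row u \is Num.real.
Proof. by rewrite ger0_real // sqrtC_ge0 ler0z int_dot_ge0. Qed.

Lemma norm_row_eq0 u : (norm_row u == 0) = (int_dot u u == 0).
Proof. by rewrite sqrtC_eq0 intr_eq0. Qed.

Lemma dotmx_int_row u v :
  dotmx (int_row u) (int_row v) = (int_dot u v)%:~R.
Proof.
rewrite dotmxE mxE int_dotE rmorph_sum; apply: eq_bigr => k _.
by rewrite !mxE rmorphM /= rmorph_int.
Qed.

Lemma dotmx_unit_row u v :
  dotmx (unit_row u) (unit_row v) =
  (norm_row u)^-1 * (norm_row v)^-1 * (int_dot u v)%:~R.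
Proof.
rewrite linearZl_LR linearZr_LR /= dotmx_int_row fmorphV /= mulrA.
(* The second scalar comes out conjugated; a real norm is its own conjugate. *)
by rewrite (CrealP (norm_row_real v)).
Qed.

Lemma dnorm_unit_row u :
  int_dot u u != 0 -> dotmx (unit_row u) (unit_row u) = 1.
Proof.
move=> u0; rewrite dotmx_unit_row -invfM -expr2 sqrtCK mulVf //.
by rewrite intr_eq0.
Qed.

Lemma unit_row_real u : unit_row u \is a realmx.
Proof.
apply/mxOverP => i j; rewrite !mxE.
by rewrite realM ?realV ?norm_row_real // realz.
Qed.

(** The single boolean equation carries both orthogonality (off the diagonal) and nonvanishing (on
    it). Orthonormal vectors are free, and [n] of them span by dimension. *)
Lemma unit_row_basis (e : 'I_n -> seq int) :
    (forall i j, (int_dot (e i) (e j) == 0) = (i != j)) ->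
  orthonormal_basis (fun i => unit_row (e i)).
Proof.
move=> eP.
have norm1 i : dotmx (unit_row (e i)) (unit_row (e i)) = 1.
  by rewrite dnorm_unit_row // eP eqxx.
have orth i j : i != j -> dotmx (unit_row (e i)) (unit_row (e j)) = 0.
  by rewrite -eP dotmx_unit_row => /eqP->; rewrite mulr0.
have inj : injective (fun i => unit_row (e i)).
  move=> i j eij; apply/eqP; apply: contraT => /orth.
  by rewrite eij norm1 => /eqP; rewrite oner_eq0.
have ortho : orthonormal (@dotmx R[i] n) (codom (fun i => unit_row (e i))).
  apply/orthonormalP; split; first by rewrite map_inj_uniq ?enum_uniq.
  move=> _ _ /codomP[i ->] /codomP[j ->]; rewrite (inj_eq inj).
  by have [->|ij] := eqVneq i j; [exact: norm1|exact: orth].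
split=> //; rewrite basisEfree (orthonormal_free ortho) subvf /=.
by rewrite dimvf size_codom card_ord dim_matrix mul1r.
Qed.

(** Proportionality is expressed by vanishing 2x2 minors, which keeps the later comparison of rays
    free of division and within the integers. *)
Lemma ray_unit_row_inj u v :
    int_dot u u != 0 -> ray (unit_row u) = ray (unit_row v) ->
  forall i j : 'I_n, u`_i * v`_j = u`_j * v`_i.
Proof.
move=> u0 eq_uv.
have : ray (unit_row u) (unit_row u) by exists 1; rewrite ?oner_eq0 ?scale1r.
rewrite eq_uv => -[l _ /rowP uE] i j.
have c0 : (norm_row u)^-1 != 0 by rewrite invr_eq0 norm_row_eq0.
(* Scaling by the inverse norm turns the coordinates of [u] into those of [unit_row u], which [uE]
   replaces by multiples of those of [v]. *)
apply: (@intr_inj R[i]); apply: (mulfI c0); rewrite !rmorphM /= !mulrA.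
have := uE i; have := uE j; rewrite !mxE => -> ->.
by rewrite !mulrA -!(mulrA _ _%:~R) [_%:~R * _]mulrC.
Qed.

End IntegerRays.

(** Numbered by first occurrence when the square is read row by row; entries 20 to 24 together with
    entry 0 form the standard basis. *)
Definition directions : seq (seq int) :=
  [:: [:: 0; 0; 0; 0; 0; 1];
      [:: 1; 2; -1; 0; -1; 0];
      [:: 1; 0; 1; 0; 0; 0];
      [:: 0; 3; 0; -2; 6; 0];
      [:: 7; -6; -7; -3; 2; 0];
      [:: 1; 0; -1; 6; 2; 0];
      [:: 0; 11; 0; -12; 15; 0];
      [:: 1; 0; -1; 0; 0; 0];
      [:: 0; 6; 0; 3; -2; 0];
      [:: 0; 3; 0; -16; -15; 0];
      [:: 7; 6; 0; 3; -2; 0];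
      [:: 2; -3; -2; 0; -2; 0];
      [:: 0; 2; 0; -6; -3; 0];
      [:: 7; -6; 14; -3; 2; 0];
      [:: 1; 0; -1; -1; 2; 0];
      [:: 3; -3; 0; 1; 3; 0];
      [:: 1; 0; 2; 0; -1; 0];
      [:: 0; 1; 0; 3; 0; 0];
      [:: 5; 9; 0; -3; 5; 0];
      [:: 1; 0; -1; 0; -1; 0];
      [:: 0; 0; 1; 0; 0; 0];
      [:: 0; 0; 0; 1; 0; 0];
      [:: 0; 0; 0; 0; 1; 0];
      [:: 1; 0; 0; 0; 0; 0];
      [:: 0; 1; 0; 0; 0; 0];
      [:: 5; -3; 0; -9; -5; 0];
      [:: 1; 0; 0; 0; 1; 0];
      [:: 0; 3; 0; -1; 0; 0];
      [:: 3; 1; 0; 3; -3; 0]].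

Definition layout : seq (seq nat) :=
  [:: [:: 0; 1; 2; 3; 4; 5];
      [:: 6; 0; 7; 8; 9; 2];
      [:: 10; 11; 0; 12; 13; 14];
      [:: 15; 16; 17; 0; 18; 19];
      [:: 20; 21; 22; 23; 0; 24];
      [:: 25; 26; 27; 20; 28; 0]]%N.

Definition symbol (i j : nat) : nat := nth 0%N (nth [::] layout i) j.

Definition direction (k : nat) : seq int := nth [::] directions k.

Lemma symbol_lt29 (i j : 'I_6) : (symbol i j < 29)%N.
Proof.
(* Over plain numbers the claim is a closed boolean, decided by evaluation. *)
have /allP/(_ i) : all (fun i => all (fun j => symbol i j < 29)%N (iota 0 6)) (iota 0 6).
  by vm_compute.
by rewrite mem_iota ltn_ord => /(_ isT)/allP/(_ j); rewrite mem_iota ltn_ord; apply.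
Qed.

Lemma symbol_onto k : (k < 29)%N -> exists i j : 'I_6, symbol i j = k.
Proof.
have /allP/(_ k) : all (fun k => has (fun i => has (fun j => symbol i j == k) (iota 0 6))
  (iota 0 6)) (iota 0 29) by vm_compute.
rewrite mem_iota => /[apply] /hasP[i + /hasP[j + /eqP <-]].
by rewrite !mem_iota => i6 j6; exists (Ordinal i6), (Ordinal j6).
Qed.

Lemma row_orthogonal (i j k : 'I_6) :
  (int_dot 6 (direction (symbol i j)) (direction (symbol i k)) == 0) = (j != k).
Proof.
have /allP/(_ i) : all (fun i => all (fun j => all (fun k =>
    (int_dot 6 (direction (symbol i j)) (direction (symbol i k)) == 0) == (j != k))
  (iota 0 6)) (iota 0 6)) (iota 0 6) by vm_compute.
rewrite mem_iota ltn_ord => /(_ isT)/allP/(_ j).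
rewrite mem_iota ltn_ord => /(_ isT)/allP/(_ k).
by rewrite mem_iota ltn_ord => /(_ isT)/eqP.
Qed.

Lemma column_orthogonal (i j k : 'I_6) :
  (int_dot 6 (direction (symbol j i)) (direction (symbol k i)) == 0) = (j != k).
Proof.
have /allP/(_ i) : all (fun i => all (fun j => all (fun k =>
    (int_dot 6 (direction (symbol j i)) (direction (symbol k i)) == 0) == (j != k))
  (iota 0 6)) (iota 0 6)) (iota 0 6) by vm_compute.
rewrite mem_iota ltn_ord => /(_ isT)/allP/(_ j).
rewrite mem_iota ltn_ord => /(_ isT)/allP/(_ k).
by rewrite mem_iota ltn_ord => /(_ isT)/eqP.
Qed.

(** Each direction occurs in the square, so the diagonal case of the row check covers it. *)
Lemma direction_neq0 k : (k < 29)%N -> int_dot 6 (direction k) (direction k) != 0.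
Proof. by move=> /symbol_onto[i [j <-]]; rewrite row_orthogonal eqxx. Qed.

Lemma direction_inj k l : (k < 29)%N -> (l < 29)%N ->
    (forall i j : 'I_6,
      (direction k)`_i * (direction l)`_j = (direction k)`_j * (direction l)`_i) ->
  k = l.
Proof.
(* For any two distinct indices the search finds a nonzero 2x2 minor. *)
have /allP/(_ k) : all (fun k => all (fun l => (k == l) ||
    has (fun i => has (fun j => (direction k)`_i * (direction l)`_j !=
        (direction k)`_j * (direction l)`_i) (iota 0 6)) (iota 0 6))
  (iota 0 29)) (iota 0 29) by vm_compute.
rewrite mem_iota => /[apply] /allP/(_ l); rewrite mem_iota => /[apply].
case/orP=> [/eqP//|/hasP[i + /hasP[j +]]]; rewrite !mem_iota => i6 j6 /eqP neq eq.
by case: neq; exact: (eq (Ordinal i6) (Ordinal j6)).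
Qed.

Theorem theorem1p1 (R : realType) :
  exists Phi : 'I_6 -> 'I_6 -> 'rV[R[i]]_6,
    [/\ quantum_latin_square Phi, real_array Phi & rays Phi #= `I_29].
Proof.
pose r k := ray (unit_row R 6 (direction k)).
exists (fun i j => unit_row R 6 (direction (symbol i j))); split.
- by split=> i; apply: unit_row_basis => j k; rewrite (row_orthogonal, column_orthogonal).
- by move=> i j; exact: unit_row_real.
(* Entries depend only on their symbol and all 29 symbols occur; injectivity of [r] on [I_29] then
   gives the count. *)
- suff -> : rays (fun i j => unit_row R 6 (direction (symbol i j))) = r @` `I_29.
    apply: inj_card_eq => k l; rewrite !inE /= => k29 l29 /ray_unit_row_inj.
    by move=> /(_ (direction_neq0 _ k29)); exact: direction_inj.
  apply/seteqP; split=> x /=.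
    by move=> [i [j ->]]; exists (symbol i j); first exact: symbol_lt29.
  by move=> [_ /symbol_onto[i [j <-]] <-]; exists i, j.
Qed.
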